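(* Let $n\ge 1$ and let $Q$ be the initial quiver of $\mathrm{Conf}_3^\times(\widetilde{\mathcal F\ell})$. The mutation sequence $\mathbf i_{\triangle_{n-2}}$, followed by $\mathbf i_{\triangle_{n-3}},\mathbf i_{\triangle_{n-4}},\dots,\mathbf i_{\triangle_1}$, is a maximal green sequence for $Q$ (the sequence being empty if $n\le 2$).
   Context: $Q$ has vertex set $\{v_{(a,b,c)}:(a,b,c)\in\mathbb Z_{\ge0}^3,\ a+b+c=n\}$; a vertex is unfrozen if $a,b,c>0$ and frozen otherwise. There is an arrow from $(a,b,c)$ to each of $(a-1,b+1,c),(a,b-1,c+1),(a+1,b,c-1)$ that is a vertex, except that arrows between two frozen vertices are omitted. The $j$-th row of unfrozen vertices ($1\le j\le n-2$) consists of the unfrozen vertices with $a=n-1-j$, ordered left to right by increasing $b$: $(n-1-j,b,j+1-b)$, $b=1,\dots,j$. $\triangle_r$ is the set of vertices in rows $1,\dots,r$, and $\mathbf i_{\triangle_r}$ is the sequence of mutations at each vertex of $\triangle_r$ once, row by row from row $1$ to row $r$, left to right in each row. The framed quiver $\widehat Q$ is $Q$ together with a new frozen vertex $w_i$ for each vertex $v_i$ and an arrow $v_i\to w_i$ for each unfrozen $v_i$. In a quiver obtained from $\widehat Q$ by mutations at unfrozen vertices, an unfrozen $v_i$ is green if all arrows between $v_i$ and the $w_j$ go out of $v_i$, and red if all such arrows go into $v_i$. A maximal green sequence for $Q$ is a finite sequence of quiver mutations starting from $\widehat Q$, each performed at an unfrozen vertex that is green at that moment, after which every unfrozen vertex is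 red. *)

(* Defs.v *)
From HB Require Import structures.
From mathcomp Require Import all_boot.
From mathcomp Require Import zify.

Set Implicit Arguments.
Unset Strict Implicit.
Unset Printing Implicit Defensive.

(* [arrows u v] is the number of arrows from u to v. Quivers are understood to
   have no loops and no 2-cycles; mutation preserves this (see below). *)
Record ice_quiver (V : eqType) := IceQuiver {
  arrows : V -> V -> nat;
  frozen : pred V }.

(* Mutation at k: each path u -> k -> v yields a new arrow u -> v, the arrows at
   k are reversed, and 2-cycles are cancelled. The truncated subtraction performs
   the cancellation. No arrow between two frozen vertices is kept. *)
Definition mutate (V : eqType) (Q : ice_quiver V) (k : V) : ice_quiver V :=
  {| arrows := fun u v =>
       if (u == k) || (v == k) then arrows Q v u
       else if frozen Q u && frozen Q v then 0
       else (arrows Q u v + arrows Q u k * arrows Q k v)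
            - (arrows Q v u + arrows Q v k * arrows Q k u);
     frozen := frozen Q |}.

Lemma mutate_no_loop (V : eqType) (Q : ice_quiver V) (k : V) :
  (forall u, arrows Q u u = 0) -> forall u, arrows (mutate Q k) u u = 0.
Proof. by move=> h u /=; rewrite h subnn; case: ifP => // _; case: ifP. Qed.

Lemma mutate_no_2cycle (V : eqType) (Q : ice_quiver V) (k : V) :
  (forall u v, arrows Q u v = 0 \/ arrows Q v u = 0) ->
  forall u v, arrows (mutate Q k) u v = 0 \/ arrows (mutate Q k) v u = 0.
Proof.
move=> h u v /=; rewrite [(v == k) || _]orbC [frozen Q v && _]andbC.
case: ifP => _; first by case: (h u v); [right | left].
by case: ifP => _; [left | lia].
Qed.

(* The vertex v_i of Q becomes [inl i]; the new frozen vertex w_i is [inr i]. *)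
Definition framed (V : eqType) (Q : ice_quiver V) : ice_quiver (V + V)%type :=
  {| arrows := fun x y =>
       match x, y with
       | inl u, inl v => arrows Q u v
       | inl u, inr w => ((u == w) && ~~ frozen Q u : nat)
       | inr _, _ => 0
       end;
     frozen := fun x => if x is inl u then frozen Q u else true |}.

Definition green (V : eqType) (K : ice_quiver (V + V)%type) (v : V) : Prop :=
  forall j : V, arrows K (inr j) (inl v) = 0.

Definition red (V : eqType) (K : ice_quiver (V + V)%type) (v : V) : Prop :=
  forall j : V, arrows K (inl v) (inr j) = 0.

Fixpoint green_sequence (V : eqType) (K : ice_quiver (V + V)%type) (s : seq V) :
    Prop :=
  if s is k :: s' then
    [/\ ~~ frozen K (inl k), green K k & green_sequence (mutate K (inl k)) s']
  else True.

Definition maximal_green_sequence (V : eqType) (Q : ice_quiver V) (s : seq V) :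
    Prop :=
  green_sequence (framed Q) s /\
  forall v : V, ~~ frozen Q v ->
    red (foldl (fun K k => mutate K (inl k)) (framed Q) s) v.

Definition triple : eqType := (nat * nat * nat)%type.

Definition vertex (n : nat) : eqType :=
  {t : triple | t.1.1 + t.1.2 + t.2 == n}.

Definition frozen_triple (t : triple) : bool :=
  ~~ [&& 0 < t.1.1, 0 < t.1.2 & 0 < t.2].

(* The three disjuncts are the arrows from (a, b, c) to (a-1, b+1, c),
   (a, b-1, c+1) and (a+1, b, c-1). *)
Definition step (s t : triple) : bool :=
  let: (a, b, c) := s in let: (a', b', c') := t in
  [|| [&& a == a'.+1, b' == b.+1 & c' == c],
      [&& a' == a, b == b'.+1 & c' == c.+1] |
      [&& a' == a.+1, b' == b & c == c'.+1]].

(* The initial quiver of Conf_3^x(Fl~). *)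
Definition conf3_quiver (n : nat) : ice_quiver (vertex n) :=
  {| arrows := fun u v =>
       (step (val u) (val v)
        && ~~ (frozen_triple (val u) && frozen_triple (val v)) : nat);
     frozen := fun u => frozen_triple (val u) |}.

Definition row_triples (n j : nat) : seq triple :=
  [seq (n - 1 - j, b, j + 1 - b) | b <- iota 1 j].

(* [insub] turns a triple of sum n into a vertex; by [val_row] no triple of a
   row is discarded. *)
Definition row (n j : nat) : seq (vertex n) := pmap insub (row_triples n j).

Definition triangle_mutations (n r : nat) : seq (vertex n) :=
  flatten [seq row n j | j <- iota 1 r].

Definition conf3_mutations (n : nat) : seq (vertex n) :=
  flatten [seq triangle_mutations n r | r <- rev (iota 1 (n - 2))].

Lemma val_row (n j : nat) :
  1 <= j <= n - 2 -> map val (row n j) = row_triples n j.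
Proof.
move=> hj; rewrite /row pmap_filter; last exact: insubK.
apply/all_filterP/allP => t /mapP [b]; rewrite mem_iota => hb ->.
by rewrite isSome_insub /=; lia.
Qed.

Lemma conf3_no_loop (n : nat) (u : vertex n) : arrows (conf3_quiver n) u u = 0.
Proof. by case: u => [[[a b] c] h] /=; lia. Qed.

Lemma conf3_no_2cycle (n : nat) (u v : vertex n) :
  arrows (conf3_quiver n) u v = 0 \/ arrows (conf3_quiver n) v u = 0.
Proof. by case: u v => [[[a b] c] hu] [[[a' b'] c'] hv] /=; lia. Qed.

(* Main.v *)
Require Import Defs.
From mathcomp Require Import all_boot.
From mathcomp Require Import zify.

(** Write an unfrozen vertex (a, b, c) as (j, b) with j = n - 1 - a its row. At
    every stage of the mutation sequence both the quiver on the unfrozen vertices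
    and the c-vectors are given by closed formulas in the number T(j, b) of
    mutations already performed at each vertex: there are only arrows between
    nearby vertices, and the c-vector of (j, b) is supported on an interval of
    rows in the column b. A vertex that is about to be mutated in round q + 1 has
    c-vector the sum over rows b + q, ..., j + q, so it is green. At the end
    T(j, b) = n - 1 - j is strictly decreasing in j, so every vertex is red. *)

Set Implicit Arguments.
Unset Strict Implicit.
Unset Printing Implicit Defensive.

(* There is an arrow from (j, b) to (i, c); all multiplicities stay 0 or 1.
   Initially T = 0 and the arrows out of (j, b) go to (j + 1, b + 1), (j, b - 1)
   and (j - 1, b). Only the value of T at positions with 0 < b <= j matters. *)
Definition arrow_at (T : nat -> nat -> nat) (j b i c : nat) : bool :=
  if i == j then
    if b == c.+1 then
      [&& T j b == T i c, T j.+1 b == T j b & T j.-1 b.-1 == T j b]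
    else if c == b.+1 then
      [&& T j b == T i c, T j.+1 c != T j b & T j.-1 b != T j b]
    else false
  else if j == i.+1 then
    if b == c.+1 then T j b != T i c else (b == c) && (T j b == T i c)
  else if i == j.+1 then
    if c == b.+1 then T j b == T i c else (b == c) && (T j b != T i c)
  else [&& i == j.+2, c == b.+1, T j.+1 b == T j b, T j.+1 c == T i c
         & T j b != T i c].

(* A mutated vertex stays red until the vertex below it in its column has been
   mutated equally often. *)
Definition is_red_at (T : nat -> nat -> nat) (j b : nat) : bool :=
  T j.+1 b < T j b.

(* The multiplicity of w_(i, c) in the negative, resp. positive, part of the
   c-vector of (j, b). *)
Definition cneg_at (T : nat -> nat -> nat) (j b i c : nat) : bool :=
  [&& c == b, is_red_at T j b
    & if (b < j) && (T j.-1 b == (T j b).+1) then i.+1 == b + T j b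
      else b + T j b <= i.+1 <= j + T j b].

Definition cpos_at (T : nat -> nat -> nat) (j b i c : nat) : bool :=
  [&& c == b, ~~ is_red_at T j b
    & if (b < j) && (T j.-1 b == (T j b).+1) then b + T j b <= i <= j + T j b
      else i == j + T j b].

(* With N = n - 2 rows: q rounds are complete, and the current one, on the rows
   1, ..., N - q, has just reached the vertex (j0, b0). *)
Definition mutation_count (N q j0 b0 j b : nat) : nat :=
  minn q (N.+1 - j)
  + (j <= N - q) && ((j < j0) || (j == j0) && (b < b0)).

(* Equations between values of T are left alone by the next two tactics. *)
Ltac split_eqs T :=
  repeat match goal with |- context [?x == ?y :> nat] =>
    match x with context [T] => fail 1 | _ =>
    match y with context [T] => fail 1 | _ =>
      case: (eqVneq x y) => [?|?]; simpl end end end;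
  try (exfalso; lia); try subst.

Ltac decide_eqs T :=
  repeat match goal with |- context [?x == ?y :> nat] =>
    match x with context [T] => fail 1 | _ =>
    match y with context [T] => fail 1 | _ =>
      first [ rewrite (_ : (x == y) = true); [|by lia]
            | rewrite (_ : (x == y) = false); [|by lia] ] end end end.

Lemma arrow_at_no_2cycle T j b i c :
  arrow_at T j b i c -> arrow_at T i c j b = false.
Proof.
rewrite /arrow_at.
case: (ltngtP i j) => [hij|hij|->]; case: (ltngtP b c) => [hbc|hbc|->].
all: split_eqs T.
all: lia.
Qed.

(** * One mutation, at (j0, b0), in terms of the closed formulas *)

Section Step.
Variables (T T' : nat -> nat -> nat) (q j0 b0 : nat).
Hypothesis valid0 : 0 < b0 <= j0.
Hypothesis count_done : forall j b,
  0 < b <= j -> (j < j0) || (j == j0) && (b < b0) -> T j b = q.+1.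
(** Row j0 + 1 has count exactly q even if it lies just outside the current triangle. Rows further
    down may have stopped earlier, so [count_below] only bounds them. *)
Hypothesis count_todo : forall j b,
  j0 <= j <= j0.+1 -> (j == j0) ==> (b0 <= b) -> T j b = q.
Hypothesis count_below : forall j b, j0 < j -> T j b <= q.
Hypothesis count_next : forall j b,
  T' j b = T j b + ((j == j0) && (b == b0)).
#[local] Set Default Proof Using "All".

Ltac eval_count :=
  repeat match goal with |- context [T ?x ?y] =>
    first [ rewrite (@count_done x y); [|lia|lia]
          | rewrite (@count_todo x y); [|lia|lia] ] end.

(** Counts are q + 1 to the left and in the row j0 - 1, and q to the right and in the row j0 + 1.
    This rules out horizontal and row-skipping arrows at (j0, b0). *)
Lemma arrow_at_in j b : 0 < b <= j ->
  arrow_at T j b j0 b0 = (b == b0) && ((j == j0.+1) || (j0 == j.+1)).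
Proof.
move=> h; rewrite /arrow_at.
split_eqs T.
all: eval_count.
all: lia.
Qed.

Lemma arrow_at_out j b : 0 < b <= j ->
  arrow_at T j0 b0 j b =
  ((b == b0.+1) && (j == j0.+1)) || ((b0 == b.+1) && (j0 == j.+1)).
Proof.
move=> h; rewrite /arrow_at.
split_eqs T.
all: eval_count.
all: lia.
Qed.

Lemma count_cur : T j0 b0 = q.
Proof. by apply: count_todo; lia. Qed.

Lemma count_down b : T j0.+1 b = q.
Proof. by apply: count_todo; lia. Qed.

Lemma cneg_at_cur i c : cneg_at T j0 b0 i c = false.
Proof. rewrite /cneg_at /is_red_at count_down count_cur; lia. Qed.

Lemma cpos_at_cur i c :
  cpos_at T j0 b0 i c = [&& c == b0, b0 + q <= i & i <= j0 + q].
Proof.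
rewrite /cpos_at /is_red_at count_down count_cur ltnn.
(* For b0 = j0 the interval shrinks to the single row j0 + q. *)
case: ltnP => hb /=; last by lia.
by rewrite count_done ?eqxx //; lia.
Qed.

Lemma cpos_at_next_cur i c : cpos_at T' j0 b0 i c = false.
Proof.
by rewrite /cpos_at /is_red_at !count_next count_down count_cur !eqxx; lia.
Qed.

Lemma cneg_at_next_cur i c : cneg_at T' j0 b0 i c = cpos_at T j0 b0 i c.
Proof.
rewrite cpos_at_cur /cneg_at /is_red_at !count_next count_down count_cur !eqxx.
case: (ltnP b0 j0) => hb /=; last by lia.
rewrite count_done; [|lia|lia].
have -> : (q.+1 + (j0.-1 == j0) && true == (q + 1).+1) = false by lia.
by lia.
Qed.

Lemma arrow_at_next_out j b : 0 < b <= j ->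
  arrow_at T' j0 b0 j b = arrow_at T j b j0 b0.
Proof.
move=> h; rewrite arrow_at_in // /arrow_at !count_next.
split_eqs T.
all: eval_count.
all: lia.
Qed.

Lemma arrow_at_next_in j b : 0 < b <= j ->
  arrow_at T' j b j0 b0 = arrow_at T j0 b0 j b.
Proof.
move=> h; rewrite arrow_at_out // /arrow_at !count_next.
split_eqs T.
all: eval_count.
all: lia.
Qed.

(** Mutation at a green vertex adds its c-vector to that of each source of an arrow into it; here
    these are the two vertical neighbours. *)
Lemma c_vector_next j b i c : 0 < b <= j -> ~~ ((j == j0) && (b == b0)) ->
  let s := cpos_at T j b i c + arrow_at T j b j0 b0 * cpos_at T j0 b0 i c in
  cpos_at T' j b i c = s - cneg_at T j b i c :> nat /\
  cneg_at T' j b i c = cneg_at T j b i c - s :> nat.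
Proof.
move=> h hk; rewrite arrow_at_in // cpos_at_cur /cpos_at /cneg_at /is_red_at.
case: (eqVneq c b) => [->|nc] /=; last first.
  by case: (eqVneq b b0) => [<-|_]; rewrite ?(negbTE nc) ?muln0.
have e j' : (j' == j0) && (b == b0) = false -> T' j' b = T j' b.
  by rewrite count_next => ->; rewrite addn0.
rewrite !(e j); last exact: negbTE.
case: (eqVneq b b0) => [eb|nb] /=; last first.
  rewrite !e ?(negbTE nb) ?andbF //; case: (_ < _); case: ifP => _; lia.
(* If (j0 + 1, b0) is green, its single row j0 + 1 + q grows to an interval starting at b0 + q; if
   it is red, only row b0 + q - 1 survives the cancellation. *)
case: (eqVneq j j0.+1) => [ej|nj] /=.
  subst; rewrite (e j0.+2); last by lia.
  rewrite count_next /= count_cur count_down.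
  rewrite !eqxx /= addn1 eqxx andbT ltnS; case/andP: valid0 => _ -> /=.
  have -> : (q == q.+1) = false by lia.
  by have := @count_below j0.+2 b0; case: ltnP; lia.
(* The vertex (j0 - 1, b0) is red with rows b0 + q, ..., j0 + q - 1; it turns green with the single
   row j0 + q. *)
case: (eqVneq j0 j.+1) => [ej|nj'] /=.
  subst b; rewrite (e j.-1); last by lia.
  rewrite -ej count_next !eqxx /= count_cur.
  rewrite (@count_done j) //; last by lia.
  rewrite addn1 ltnn ltnSn /=.
  have -> : (b0 < j) && (T j.-1 b0 == q.+2) = false.
    by case: ltnP => //= hb; rewrite count_done //; lia.
  by lia.
by rewrite !e; lia.
Qed.

(** Besides the two ends, [arrow_at] reads [T] only at positions that, if mutated now, would be the
    middle of a path between the ends. Without such a path it reads no changed value. *)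
Lemma arrow_at_next_far j b i c :
  0 < b <= j -> 0 < c <= i ->
  ~~ ((j == j0) && (b == b0)) -> ~~ ((i == j0) && (c == b0)) ->
  arrow_at T j b j0 b0 && arrow_at T j0 b0 i c = false ->
  arrow_at T i c j0 b0 && arrow_at T j0 b0 j b = false ->
  arrow_at T' j b i c = arrow_at T j b i c.
Proof.
move=> h1 h2 n1 n2; rewrite !arrow_at_in // !arrow_at_out // => g1 g2.
have e j' b' : (j' == j0) && (b' == b0) = false -> T' j' b' = T j' b'.
  by rewrite count_next => ->; rewrite addn0.
rewrite /arrow_at (e j b) ?(e i c); try exact: negbTE.
do ![case: ifP => [/eqP ?|_]]; subst => //.
all: try by rewrite !e //; lia.
by case: eqP => //= ?; case: eqP => //= ?; subst; rewrite !e //; lia.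
Qed.

(** Each path through (j0, b0) either creates an arrow or cancels an opposite one. *)
Lemma arrow_at_next_cross j b i c :
  0 < b <= j -> 0 < c <= i ->
  arrow_at T j b j0 b0 -> arrow_at T j0 b0 i c ->
  arrow_at T' j b i c + arrow_at T i c j b = (arrow_at T j b i c).+1 /\
  arrow_at T' i c j b = false.
Proof.
move=> h1 h2; rewrite arrow_at_in // arrow_at_out // => /andP [/eqP eb].
case/orP => /eqP ej /orP [] /andP [/eqP ec /eqP ei]; subst b.
all: rewrite /arrow_at !count_next.
all: decide_eqs T; rewrite /= ?addn0.
all: eval_count; decide_eqs T => //=.
(* With both ends in row j0 + 1, the count at (j0 + 2, b0 + 1) decides between creation and
   cancellation. *)
by rewrite !andbT ei -ej; case: (_ == q).
Qed.

Lemma arrow_at_next j b i c :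
  0 < b <= j -> 0 < c <= i ->
  ~~ ((j == j0) && (b == b0)) -> ~~ ((i == j0) && (c == b0)) ->
  arrow_at T' j b i c =
  (arrow_at T j b i c + arrow_at T j b j0 b0 * arrow_at T j0 b0 i c)
  - (arrow_at T i c j b + arrow_at T i c j0 b0 * arrow_at T j0 b0 j b) :> nat.
Proof.
move=> h1 h2 n1 n2.
case: (boolP (arrow_at T j b j0 b0 && arrow_at T j0 b0 i c))
  => [/andP[a1 a2]|/negbTE g1].
  have [x y] := arrow_at_next_cross h1 h2 a1 a2.
  rewrite a1 a2 (arrow_at_no_2cycle a1) (arrow_at_no_2cycle a2); lia.
case: (boolP (arrow_at T i c j0 b0 && arrow_at T j0 b0 j b))
  => [/andP[a1 a2]|/negbTE g2].
  have [x y] := arrow_at_next_cross h2 h1 a1 a2.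
  rewrite a1 a2 (arrow_at_no_2cycle a1) (arrow_at_no_2cycle a2); lia.
rewrite arrow_at_next_far //.
rewrite !mulnb g1 g2 !addn0.
case E: (arrow_at T j b i c); last by rewrite sub0n.
by rewrite (arrow_at_no_2cycle E).
Qed.

End Step.

(** * The counts along the mutation sequence *)

Section Count.
Variables (N q j0 b0 : nat).
Hypothesis valid0 : [&& 0 < b0, b0 <= j0, j0 <= N - q & q < N].
Let T := mutation_count N q j0 b0.

Lemma mutation_count_done j b :
  0 < b <= j -> (j < j0) || (j == j0) && (b < b0) -> T j b = q.+1.
Proof.
by move: valid0; rewrite /T /mutation_count => h h1 h2; rewrite h2; lia.
Qed.

Lemma mutation_count_todo j b :
  j0 <= j <= j0.+1 -> (j == j0) ==> (b0 <= b) -> T j b = q.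
Proof.
move: valid0; rewrite /T /mutation_count => h h1 h2.
have -> : (j < j0) || (j == j0) && (b < b0) = false by lia.
by rewrite andbF addn0; lia.
Qed.

Lemma mutation_count_below j b : j0 < j -> T j b <= q.
Proof.
move: valid0; rewrite /T /mutation_count => h h1.
have -> : (j < j0) || (j == j0) && (b < b0) = false by lia.
by rewrite andbF addn0; lia.
Qed.

Lemma mutation_count_next j b :
  mutation_count N q j0 b0.+1 j b = T j b + ((j == j0) && (b == b0)).
Proof.
move: valid0; rewrite /T /mutation_count => h; rewrite -addnA; congr (_ + _).
case: (altP (j =P j0)) => /= [->|_]; last by rewrite addn0.
by rewrite ltnn /=; case: (ltngtP b b0) => hb; lia.
Qed.

End Count.

Lemma arrow_at_eq T T' j b i c :
  (forall j b, 0 < b <= j -> T j b = T' j b) ->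
  0 < b <= j -> 0 < c <= i -> arrow_at T j b i c = arrow_at T' j b i c.
Proof.
move=> e h1 h2; rewrite /arrow_at (e j b) // (e i c) //.
do ![case: ifP => [/eqP ?|_]]; subst => //.
all: try by rewrite !e //; lia.
by case: eqP => //= ?; case: eqP => //= ?; subst; rewrite !e //; lia.
Qed.

Lemma c_vector_eq T T' j b i c :
  (forall j b, 0 < b <= j -> T j b = T' j b) -> 0 < b <= j ->
  cpos_at T j b i c = cpos_at T' j b i c /\
  cneg_at T j b i c = cneg_at T' j b i c.
Proof.
move=> e h; rewrite /cpos_at /cneg_at /is_red_at (e j b) // (e j.+1 b);
  last by lia.
by case: (ltnP b j) => //= ?; rewrite e //; lia.
Qed.

(** * The closed formulas as an invariant of the framed quiver *)

Section Invariant.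
Variable n : nat.
Implicit Types (u v w : vertex n) (K : ice_quiver (vertex n + vertex n)%type).

Definition unfrozen v := ~~ frozen_triple (val v).
Definition vrow v := n - 1 - (val v).1.1.
Definition vpos v := (val v).1.2.

Lemma unfrozen_bounds v : unfrozen v -> 0 < vpos v <= vrow v /\ vrow v <= n - 2.
Proof.
rewrite /unfrozen /vrow /vpos; case: v => [[[a b] c] /= h].
by rewrite /frozen_triple /=; lia.
Qed.

(** Truncation in [vrow] sends both a = n and a = n - 1 to row 0, which contains no unfrozen u; so v
    may be frozen. *)
Lemma eq_vertex u v :
  unfrozen u -> (u == v) = (vrow v == vrow u) && (vpos v == vpos u).
Proof.
rewrite /unfrozen /vrow /vpos -val_eqE.
case: u v => [[[a b] c] /= h] [[[a' b'] c'] /= h']; rewrite /frozen_triple /=.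
by rewrite !xpair_eqE; lia.
Qed.

Definition invariant T K :=
  [/\ frozen K =1 frozen (framed (conf3_quiver n)),
      forall u v, unfrozen u -> unfrozen v ->
        arrows K (inl u) (inl v) = arrow_at T (vrow u) (vpos u) (vrow v) (vpos v),
      forall u w, unfrozen u ->
        arrows K (inl u) (inr w) = cpos_at T (vrow u) (vpos u) (vrow w) (vpos w)
    & forall u w, unfrozen u ->
        arrows K (inr w) (inl u) = cneg_at T (vrow u) (vpos u) (vrow w) (vpos w)].

(** This serves to pass to the next row or round, where the two count functions agree only at valid
    positions. *)
Lemma invariant_eq T T' K :
  (forall j b, 0 < b <= j -> T j b = T' j b) -> invariant T K -> invariant T' K.
Proof.
move=> e [h1 h2 h3 h4]; split=> // u v.
- move=> hu hv; rewrite h2 //; congr nat_of_bool.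
  by apply: arrow_at_eq => //; apply: (unfrozen_bounds _).1.
- move=> hu; rewrite h3 //; congr nat_of_bool.
  by apply: (c_vector_eq _ _ _ _).1 => //; apply: (unfrozen_bounds _).1.
- move=> hu; rewrite h4 //; congr nat_of_bool.
  by apply: (c_vector_eq _ _ _ _).2 => //; apply: (unfrozen_bounds _).1.
Qed.

Lemma invariant_framed :
  invariant (mutation_count (n - 2) 0 1 1) (framed (conf3_quiver n)).
Proof.
have T0 j b : 0 < b <= j -> mutation_count (n - 2) 0 1 1 j b = 0.
  by rewrite /mutation_count; lia.
have : invariant (fun _ _ => 0) (framed (conf3_quiver n)).
  split=> //= u v.
  - rewrite /vrow /vpos /unfrozen /arrow_at.
    case: u v => [[[a b] c] /= hu'] [[[a' b'] c'] /= hv'] hu hv.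
    rewrite (negbTE hu) /= andbT; congr nat_of_bool.
    move: hu hv; rewrite /frozen_triple /= => hu hv.
    by do ![case: ifP => [/eqP ?|/eqP ?]]; lia.
  - move=> hu; rewrite eq_vertex // [~~ _]hu /cpos_at /is_red_at /= andbT !addn0.
    by rewrite andbF andbC.
  - by move=> hu; rewrite /cneg_at /is_red_at ltnn andbF.
by apply: invariant_eq => j b h; rewrite T0.
Qed.

Lemma invariant_mutate q j0 b0 k K :
  [&& 0 < b0, b0 <= j0, j0 <= n - 2 - q & q < n - 2] ->
  vrow k = j0 -> vpos k = b0 ->
  unfrozen k -> invariant (mutation_count (n - 2) q j0 b0) K ->
  [/\ ~~ frozen K (inl k), green K k
    & invariant (mutation_count (n - 2) q j0 b0.+1) (mutate K (inl k))].
Proof.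
move=> h0 ej eb hk [hf ha hp hn].
set T := mutation_count _ _ _ _ in ha hp hn *; set T' := mutation_count _ _ _ _.
have cd := mutation_count_done h0.
have ct := mutation_count_todo h0.
have cb := mutation_count_below h0.
have cn := mutation_count_next h0.
have v0 : 0 < b0 <= j0 by lia.
(* Hence no path from some w to u through k can contribute to a c-vector. *)
have green_k w : arrows K (inr w) (inl k) = 0.
  by rewrite hn // ej eb (cneg_at_cur v0 cd ct cb cn).
have fu v : unfrozen v -> frozen K (inl v) = false by rewrite hf => /negbTE.
have inlE u v : (inl u == inl v :> vertex n + vertex n) = (u == v) by [].
split=> //; first by rewrite fu.
split=> [x|u v hu hv|u w hu|u w hu] /=; first exact: hf.
- have hbv := (unfrozen_bounds hv).1.
  rewrite !inlE; case: eqVneq => [->|nu] /=.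
    by rewrite ha // ej eb (arrow_at_next_out v0 cd ct cb cn).
  have hbu := (unfrozen_bounds hu).1.
  case: eqVneq => [->|nv] /=.
    by rewrite ha // ej eb (arrow_at_next_in v0 cd ct cb cn).
  rewrite fu //= !ha // ej eb (arrow_at_next v0 cd ct cb cn) //.
    by rewrite -ej -eb eq_sym [X in _ && X]eq_sym -eq_vertex.
  by rewrite -ej -eb eq_sym [X in _ && X]eq_sym -eq_vertex.
- rewrite inlE orbF; case: eqVneq => [->|nu] /=.
    by rewrite green_k ej eb (cpos_at_next_cur v0 cd ct cb cn).
  rewrite fu //= green_k mul0n addn0 !hp // hn // ha // ej eb.
  have hbu := (unfrozen_bounds hu).1.
  have [|-> _] := c_vector_next v0 cd ct cb cn (vrow w) (vpos w) hbu.
    by rewrite -ej -eb eq_sym [X in _ && X]eq_sym -eq_vertex.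
  by [].
- rewrite inlE; case: eqVneq => [->|nu] /=.
    by rewrite hp // ej eb (cneg_at_next_cur v0 cd ct cb cn).
  rewrite fu // andbF green_k mul0n addn0 !hp // hn // ha // ej eb.
  have hbu := (unfrozen_bounds hu).1.
  have [|_ ->] := c_vector_next v0 cd ct cb cn (vrow w) (vpos w) hbu.
    by rewrite -ej -eb eq_sym [X in _ && X]eq_sym -eq_vertex.
  by [].
Qed.

(** * Hoare triples for rows, triangles and the whole sequence *)

Definition runs (P : ice_quiver (vertex n + vertex n)%type -> Prop) s P' :=
  forall K, P K ->
    green_sequence K s /\ P' (foldl (fun K k => mutate K (inl k)) K s).

Lemma runs_cat P s P' s' P'' :
  runs P s P' -> runs P' s' P'' -> runs P (s ++ s') P''.
Proof.
move=> h h' K /h; rewrite foldl_cat.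
elim: s K {h} => [|k s IHs] K /=; first by case=> _ /h'.
by case=> -[fk gk gs] /(conj gs)/IHs[].
Qed.

Lemma runs_row q j m :
  q < n - 2 -> 0 < j <= n - 2 - q -> m <= j ->
  runs (invariant (mutation_count (n - 2) q j 1))
    (pmap insub [seq (n - 1 - j, b, j + 1 - b) | b <- iota 1 m])
    (invariant (mutation_count (n - 2) q j m.+1)).
Proof.
move=> hq hj; elim: m => [|m IHm] hm; first by move=> K hK.
rewrite -[in iota _ _](addn1 m) iotaD map_cat pmap_cat add1n.
apply: runs_cat (IHm (ltnW hm)) _ => K /=.
case: insubP => [k _ ek|/=]; last by lia.
move=> hK; case: (@invariant_mutate q j m.+1 k K) => //.
- by lia.
- by rewrite /vrow ek /=; lia.
- by rewrite /vpos ek.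
- by rewrite /unfrozen ek /frozen_triple /=; lia.
Qed.

Lemma runs_triangle q m :
  q < n - 2 -> m <= n - 2 - q ->
  runs (invariant (mutation_count (n - 2) q 1 1)) (triangle_mutations n m)
    (invariant (mutation_count (n - 2) q m.+1 1)).
Proof.
move=> hq; elim: m => [|m IHm] hm; first by move=> K hK.
rewrite /triangle_mutations -[in iota _ _](addn1 m) iotaD map_cat flatten_cat.
rewrite /= cats0 add1n.
apply: runs_cat (IHm (ltnW hm)) _ => K hK0.
have hm' : 0 < m.+1 <= n - 2 - q by [].
have [gs hK] := runs_row hq hm' (leqnn _) hK0.
split=> //; apply: invariant_eq hK => j b h.
by rewrite /mutation_count; lia.
Qed.

(** Triangles lose one row per round, so with m triangles left exactly n - 2 - m rounds are
    complete. *)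
Lemma runs_triangles m :
  m <= n - 2 ->
  runs (invariant (mutation_count (n - 2) (n - 2 - m) 1 1))
    (flatten [seq triangle_mutations n r | r <- rev (iota 1 m)])
    (invariant (mutation_count (n - 2) (n - 2) 1 1)).
Proof.
elim: m => [|m IHm] hm; first by move=> K; rewrite subn0.
rewrite -[in iota _ _](addn1 m) iotaD rev_cat /= add1n.
apply: (runs_cat _ (IHm (ltnW hm))) => K hK0.
have hq : n - 2 - m.+1 < n - 2 by lia.
have hm' : m.+1 <= n - 2 - (n - 2 - m.+1) by rewrite subKn.
have [gs hK] := runs_triangle hq hm' hK0.
split=> //; apply: invariant_eq hK => j b h.
by rewrite /mutation_count; lia.
Qed.

End Invariant.

Theorem proposition10 (n : nat) (hn : 1 <= n) :
  maximal_green_sequence (conf3_quiver n) (conf3_mutations n).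
Proof.
have hruns := runs_triangles (leqnn (n - 2)); rewrite subnn in hruns.
have [gs [_ _ hpos _]] := hruns _ (invariant_framed n); split=> // v hv w.
have [hb hN] := unfrozen_bounds hv.
rewrite hpos // /cpos_at /is_red_at /mutation_count; lia.
Qed.
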